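(* Every finite hyperfield that is ample has the FETVINS property.
   Context: **Hyperfield.** For a nonempty set $H$, let $\mathcal{P}^*(H)$ be the set of nonempty subsets of $H$. A hyperaddition is a map $+ : H\times H \to \mathcal{P}^*(H)$ with $a+b=b+a$ and $(a+b)+c=a+(b+c)$, where $A+x=\bigcup_{a\in A}(a+x)$ for $A\subseteq H$ (a one-element set is identified with its element). A hyperfield is a set $H$ with a hyperaddition and an ordinary commutative multiplication such that: (Zero) there is a unique $0\in H$ with $0+h=h$ for all $h$; (Negative) for each $x$ there is a unique $y=:-x$ with $0\in x+y$; (Reversibility) if $x\in y+z$ then $z\in x+(-y)$; $(H,\cdot)$ is a monoid; $a(b+c)=ab+ac$ for all $a,b,c$; $r\cdot 0=0$ for all $r$; and $H^\times=H-\{0\}$ is a group under multiplication. **Ample.** Let $H$ be a finite hyperfield. Let $m$ be the largest number such that $|(w+1)-\{0\}| \geq m$ for all $w \in H^\times$, and let $k$ be the largest number such that $|\{u \in H^\times : w \in u+1\}| \geq k$ for all $w \in H^\times$. $H$ is ample iff $m+k>|H^\times|$. **FETVINS.** A homogeneous linear equation over a hyperfield $F$ in variables $x_1,\dots,x_n$ is a condition $0\in a_1x_1+a_2x_2+\dots+a_nx_n$ with coefficients $a_j\in F$. $F$ has FETVINS (''Fewer Equations Than Variables Implies Nontrivial Solutions'') iff for every system of $k$ homogeneous linear equations in $n$ variables with $k<n$, there are values $x_1,\dots,x_n\in F$, not all zero, such that all $k$ of the equations are true. *)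

(* Defs.v *)
From HB Require Import structures.
From mathcomp Require Import all_boot.

Set Implicit Arguments.
Unset Strict Implicit.
Unset Printing Implicit Defensive.

(* That H - {0} is a group under hmul is the content of the last three axioms,
   associativity and the unit law being inherited from the monoid H. *)
HB.mixin Record isHyperfield H of Finite H := {
  hadd : H -> H -> {set H};
  hmul : H -> H -> H;
  hzero : H;
  hone : H;
  hopp : H -> H;
  hadd_neq0 : forall a b, hadd a b != set0;
  haddC : forall a b, hadd a b = hadd b a;
  haddA : forall a b c,
    \bigcup_(d in hadd a b) hadd d c = \bigcup_(d in hadd b c) hadd a d;
  hadd0 : forall h, hadd hzero h = [set h];
  hzero_uniq : forall z, (forall h, hadd z h = [set h]) -> z = hzero;
  hadd_opp : forall x, hzero \in hadd x (hopp x);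
  hopp_uniq : forall x y, hzero \in hadd x y -> y = hopp x;
  hadd_rev : forall x y z, x \in hadd y z -> z \in hadd x (hopp y);
  hmulC : forall a b, hmul a b = hmul b a;
  hmulA : forall a b c, hmul a (hmul b c) = hmul (hmul a b) c;
  hmul1 : forall a, hmul hone a = a;
  hmulDr : forall a b c,
    [set hmul a x | x in hadd b c] = hadd (hmul a b) (hmul a c);
  hmulr0 : forall r, hmul r hzero = hzero;
  hone_neq0 : hone != hzero;
  hmul_neq0 : forall a b, a != hzero -> b != hzero -> hmul a b != hzero;
  hmulV_ex : forall a, a != hzero -> exists2 b, b != hzero & hmul b a = hone
}.

#[short(type="finHyperfieldType")]
HB.structure Definition FinHyperfield := {H of isHyperfield H & Finite H}.

Declare Scope hyperfield_scope.
Delimit Scope hyperfield_scope with HF.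
Notation "0" := hzero : hyperfield_scope.
Notation "1" := hone : hyperfield_scope.
Notation "a + b" := (hadd a b) : hyperfield_scope.
Notation "a * b" := (hmul a b) : hyperfield_scope.

Definition hunits (H : finHyperfieldType) : {set H} := [set~ 0%HF].

Definition is_largest (P : nat -> Prop) (m : nat) : Prop :=
  P m /\ forall n, P n -> n <= m.

Definition ample (H : finHyperfieldType) : Prop :=
  exists m k : nat,
    [/\ is_largest
          (fun m => forall w : H, w \in hunits H -> #|(w + 1)%HF :\ 0%HF| >= m)
          m,
        is_largest
          (fun k => forall w : H, w \in hunits H ->
             #|[set u in hunits H | w \in (u + 1)%HF]| >= k)
          k
      & m + k > #|hunits H|].

Definition hadds (H : finHyperfieldType) (A B : {set H}) : {set H} :=
  \bigcup_(a in A) \bigcup_(b in B) (a + b)%HF.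

(* The set f_0 + ... + f_(n-1); as 0 + h = {h}, starting the iteration from {0}
   changes nothing for n > 0, and the empty sum is {0}. *)
Definition hsum (H : finHyperfieldType) (n : nat) (f : 'I_n -> H) : {set H} :=
  \big[@hadds H/[set 0%HF]]_(j < n) [set f j].

Definition FETVINS (F : finHyperfieldType) : Prop :=
  forall (k n : nat) (a : 'I_k -> 'I_n -> F), k < n ->
    exists x : 'I_n -> F,
      (exists j, x j <> 0%HF) /\
      (forall i, 0%HF \in hsum (fun j => (a i j * x j)%HF)).

(* Main.v *)
Require Import Defs.
From HB Require Import structures.
From mathcomp Require Import all_boot.

Set Implicit Arguments.
Unset Strict Implicit.
Unset Printing Implicit Defensive.

(** Write a unit for a nonzero element. Ampleness says that two sums [a + b]
    and [c + d] of two units are so large that they share a unit (lemma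
    [common_unit]). Hence a sum of at least four units contains 0
    ([zero_in_sum4]), and two conditions of the form [z \in b + c], with [b]
    and [c] units, have a common solution [z] that is a unit
    ([common_unit_family]).

    The system is solved by induction on the number of equations. Let [S] be a
    set of variables such that at least [#|S|] equations, and at least one,
    involve only variables of [S]: setting the variables of [S] to 0 satisfies
    these equations and leaves a smaller system that still has fewer equations
    than variables. An equation in exactly two variables can be used to
    eliminate one of them: every coefficient set [c + c' * t] that arises is
    replaced by one of its elements, which only strengthens the equations.

    When neither reduction applies, every equation has at least three terms and
    there is a solution all of whose values are units. The equations with four
    terms or more then hold automatically. For the others, any nonempty set [S]
    of variables contains the support of fewer than [#|S|] three-term
    equations, so by double counting some variable of [S] occurs in at most two
    of them ([low_degree]). Choosing that variable last, after the other
    variables of [S] have their values, amounts to solving at most two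
    conditions [z \in b + c] ([unit_assignment]). *)

Local Open Scope hyperfield_scope.

(** * Arithmetic of hyperfields *)

Lemma mem_hmulD (H : finHyperfieldType) (a b c w : H) :
  w \in b + c -> a * w \in a * b + a * c.
Proof. by move=> wbc; rewrite -hmulDr; apply/imsetP; exists w. Qed.

Lemma hopp_mul1 (H : finHyperfieldType) (a : H) : hopp 1 * a = hopp a.
Proof.
apply: hopp_uniq; have := mem_hmulD a (hadd_opp (1 : H)).
by rewrite hmulr0 !(hmulC a) hmul1.
Qed.

Lemma hoppK (H : finHyperfieldType) : involutive (@hopp H).
Proof. by move=> a; apply/esym/hopp_uniq; rewrite haddC hadd_opp. Qed.

Lemma hopp0 (H : finHyperfieldType) : hopp 0 = 0 :> H.
Proof. by rewrite -hopp_mul1 hmulr0. Qed.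

Lemma hopp_neq0 (H : finHyperfieldType) (a : H) : a != 0 -> hopp a != 0.
Proof. by apply: contraNneq => a0; rewrite -(hoppK a) a0 hopp0. Qed.

Lemma hmul_inj (H : finHyperfieldType) (a : H) : a != 0 -> injective (hmul a).
Proof.
move=> /hmulV_ex[b _ ba1] x y eqxy.
by rewrite -(hmul1 x) -(hmul1 y) -ba1 -!hmulA eqxy.
Qed.

Lemma mem_hopp_hadd (H : finHyperfieldType) (a b w : H) :
  w \in hopp a + hopp b -> hopp w \in a + b.
Proof. by move=> /(mem_hmulD (hopp 1)); rewrite !hopp_mul1 !hoppK. Qed.

(** * Sums of sets *)

Lemma haddsP (H : finHyperfieldType) (A B : {set H}) (w : H) :
  reflect (exists a b, [/\ a \in A, b \in B & w \in a + b]) (w \in hadds A B).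
Proof.
apply: (iffP bigcupP) => [[a aA /bigcupP[b bB wab]]|[a [b [aA bB wab]]]].
  by exists a, b.
by exists a => //; apply/bigcupP; exists b.
Qed.

Lemma haddsA (H : finHyperfieldType) : associative (@hadds H).
Proof.
move=> A B C; apply/setP=> w; apply/haddsP/haddsP.
  move=> [a [d [aA /haddsP[b [c [bB cC dbc]]] wad]]].
  have: w \in \bigcup_(d in b + c) (a + d) by apply/bigcupP; exists d.
  rewrite -haddA => /bigcupP[e eab wec].
  by exists e, c; split=> //; apply/haddsP; exists a, b.
move=> [d [c [/haddsP[a [b [aA bB dab]]] cC wdc]]].
have: w \in \bigcup_(d in a + b) (d + c) by apply/bigcupP; exists d.
rewrite haddA => /bigcupP[e ebc wae].
by exists a, e; split=> //; apply/haddsP; exists b, c.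
Qed.

Lemma haddsC (H : finHyperfieldType) : commutative (@hadds H).
Proof.
move=> A B; apply/setP=> w.
by apply/haddsP/haddsP=> -[a [b [aA bB wab]]]; exists b, a; rewrite haddC.
Qed.

Lemma hadds0 (H : finHyperfieldType) : left_id [set (0 : H)] (@hadds H).
Proof.
move=> A; apply/setP=> w; apply/haddsP/idP=> [[a [b []]]|wA].
  by rewrite inE => /eqP-> bA; rewrite hadd0 inE => /eqP->.
by exists 0, w; rewrite hadd0 !inE.
Qed.

HB.instance Definition _ (H : finHyperfieldType) :=
  Monoid.isComLaw.Build {set H} [set (0 : H)] (@hadds H)
    (@haddsA H) (@haddsC H) (@hadds0 H).

Lemma haddsS (H : finHyperfieldType) (A A' B B' : {set H}) :
  A \subset A' -> B \subset B' -> hadds A B \subset hadds A' B'.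
Proof.
move=> sAA' sBB'; apply/subsetP=> w /haddsP[a [b [aA bB wab]]].
by apply/haddsP; exists a, b; rewrite (subsetP sAA') ?(subsetP sBB').
Qed.

Lemma hadds1 (H : finHyperfieldType) (a b : H) :
  hadds [set a] [set b] = a + b.
Proof. by rewrite /hadds !big_set1. Qed.

(** * Sums of units in a hyperfield in which sums of two units meet *)

Definition meeting_sums (H : finHyperfieldType) : Prop :=
  forall a b c d : H, a != 0 -> b != 0 -> c != 0 -> d != 0 ->
  exists u, [/\ u != 0, u \in a + b & u \in c + d].

(** After scaling by [b], the first constant of ampleness bounds below the
    number of units in [a + b]; after scaling by [- d] and by reversibility,
    the second one does so for [c + d]. Both sets lie in the units, so they
    meet when the two bounds add up to more than the number of units. *)
Lemma common_unit (H : finHyperfieldType) : ample H -> meeting_sums H.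
Proof.
move=> [m [k [[mP _] [kP _] mk]]] a b c d a0 b0 c0 d0.
have leA : m <= #|(a + b) :\ 0|.
  have [b' b'0 b'b] := hmulV_ex b b0.
  have /mP lem : b' * a \in hunits H by rewrite !inE hmul_neq0.
  apply: leq_trans lem _; rewrite -(card_imset _ (hmul_inj b0)).
  apply/subset_leq_card/subsetP=> _ /imsetP[w /setD1P[w0 wab] ->].
  rewrite !inE hmul_neq0 //=; move/(mem_hmulD b): wab.
  by rewrite hmulA (hmulC b b') b'b hmul1 (hmulC b 1) hmul1.
have leB : k <= #|(c + d) :\ 0|.
  have e0 := hopp_neq0 d0; have [e' e'0 e'e] := hmulV_ex _ e0.
  have /kP lek : e' * c \in hunits H by rewrite !inE hmul_neq0.
  apply: leq_trans lek _; rewrite -(card_imset _ (hmul_inj e0)).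
  apply/subset_leq_card/subsetP=> _ /imsetP[v /[!inE] /andP[v0 vec] ->].
  rewrite hmul_neq0 //=; move/(mem_hmulD (hopp d)): vec.
  rewrite hmulA (hmulC _ e') e'e hmul1 (hmulC _ 1) hmul1 haddC.
  by move/hadd_rev; rewrite hoppK.
have: #|((a + b) :\ 0) :&: ((c + d) :\ 0)| != 0%N.
  apply: contraTneq mk => I0; rewrite -leqNgt.
  apply: leq_trans (leq_add leA leB) _; rewrite -cardsUI I0 addn0.
  by apply/subset_leq_card/subsetP=> u; rewrite !inE => /orP[] /andP[].
rewrite cards_eq0 => /set0Pn[u]; rewrite !inE => /andP[/andP[u0 uab] /andP[_ ucd]].
by exists u.
Qed.

(** For three units, [w \in a + b + c] amounts to [a + b] meeting [w - c].
    A further summand [a] is absorbed by choosing a unit in [w - a]. *)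
Lemma unit_in_sum3 (H : finHyperfieldType) (J : finType) (A : {set J})
    (f : J -> H) (w : H) :
  meeting_sums H -> (forall j, j \in A -> f j != 0) -> 2 < #|A| -> w != 0 ->
  w \in \big[@hadds H/[set 0]]_(j in A) [set f j].
Proof.
move=> meetH; have [n] := ubnP #|A|; elim: n A w => // n IHn A w ltAn f0 A3 w0.
have [p pA] : exists p, p \in A by apply/card_gt0P; apply: leq_trans A3.
have := A3; rewrite (cardsD1 p) pA ltnS => A2.
have subA j : j \in A :\ p -> j \in A by case/setD1P.
have g0 : hopp (f p) != 0 by rewrite hopp_neq0 ?f0.
rewrite (big_setD1 p) //=; apply/haddsP.
suff: exists u, u \in w + hopp (f p) /\
    u \in \big[@hadds H/[set 0]]_(j in A :\ p) [set f j].
  move=> [u [uw uA]]; exists (f p), u; rewrite inE; split=> //.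
  by move: uw; rewrite haddC => /hadd_rev; rewrite hoppK haddC.
have [A3'|A2'] := ltnP 2 #|A :\ p|.
  have [u [u0 uw _]] := meetH _ _ _ _ w0 g0 w0 g0.
  exists u; split=> //; apply: IHn => //; last by move=> j /subA/f0.
  by move: ltAn; rewrite (cardsD1 p) pA.
have /cards2P[q [r [qr defA]]] : #|A :\ p| == 2 by rewrite eqn_leq A2' A2.
have [q0 r0] : f q != 0 /\ f r != 0.
  by split; apply/f0/subA; rewrite defA !inE eqxx ?orbT.
have [u [_ uw uqr]] := meetH _ _ _ _ w0 g0 q0 r0.
by exists u; rewrite defA big_setU1 ?inE //= big_set1 hadds1.
Qed.

Lemma zero_in_sum4 (H : finHyperfieldType) (J : finType) (A : {set J})
    (f : J -> H) :
  meeting_sums H -> (forall j, j \in A -> f j != 0) -> 3 < #|A| ->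
  0 \in \big[@hadds H/[set 0]]_(j in A) [set f j].
Proof.
move=> meetH f0 A4.
have [p pA] : exists p, p \in A by apply/card_gt0P; apply: leq_trans A4.
have := A4; rewrite (cardsD1 p) pA ltnS => A3.
rewrite (big_setD1 p) //=; apply/haddsP; exists (f p), (hopp (f p)).
rewrite inE hadd_opp; split=> //; apply: unit_in_sum3 => //.
  by move=> j /setD1P[_ /f0].
by rewrite hopp_neq0 ?f0.
Qed.

Lemma common_unit_family (H : finHyperfieldType) (I : finType) (D : {set I})
    (A : I -> {set H}) :
  meeting_sums H -> #|D| <= 2 ->
  (forall i, i \in D -> exists b c, [/\ b != 0, c != 0 & b + c \subset A i]) ->
  exists2 z, z != 0 & forall i, i \in D -> z \in A i.
Proof.
move=> meetH D2 AP.
have [/eqP D0|[p pD]] := set_0Vmem D.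
  by exists 1 => [|i]; rewrite ?hone_neq0 // (eqP D0) inE.
have [b [c [b0 c0 bcA]]] := AP p pD.
have [/eqP D0|[q qD]] := set_0Vmem (D :\ p).
  have [z [z0 zbc _]] := meetH _ _ _ _ b0 c0 b0 c0.
  exists z => // i iD; have [->|ip] := eqVneq i p; first exact: subsetP zbc.
  by have: i \in D :\ p by [rewrite !inE ip]; rewrite (eqP D0) inE.
have [d [e [d0 e0 deA]]] := AP q (subsetP (subsetDl _ _) _ qD).
have [z [z0 zbc zde]] := meetH _ _ _ _ b0 c0 d0 e0.
exists z => // i iD; have [->|ip] := eqVneq i p; first exact: subsetP zbc.
have [->|iq] := eqVneq i q; first exact: subsetP zde.
move: D2; rewrite (cardsD1 p) pD (cardsD1 q) qD (cardsD1 i).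
by rewrite !inE iq ip iD.
Qed.

(** * Assigning units to the variables of a sparse system *)

Definition supp (H : finHyperfieldType) (J : finType) (V : {set J})
    (c : J -> H) : {set J} := [set j in V | c j != 0].

Definition lsum (H : finHyperfieldType) (J : finType) (A : {set J})
    (c x : J -> H) : {set H} :=
  \big[@hadds H/[set 0]]_(j in A) [set c j * x j].

Lemma lsum_supp (H : finHyperfieldType) (J : finType) (V : {set J})
    (c x : J -> H) : lsum V c x = lsum (supp V c) c x.
Proof.
rewrite [RHS](eq_bigl (fun j => (j \in V) && (c j != 0))); last first.
  by move=> j; rewrite !inE.
rewrite big_mkcondr; apply: eq_bigr => j _; case: eqP => //= ->.
by rewrite hmulC hmulr0.
Qed.

(** Double counting: the degrees add up to three times the number of blocks,
    which is less than three times the number of points. *)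
Lemma low_degree (I J : finType) (T : {set I}) (S : {set J})
    (B : I -> {set J}) :
  (forall i, i \in T -> B i \subset S /\ #|B i| = 3) -> #|T| < #|S| ->
  exists2 j, j \in S & #|[set i in T | j \in B i]| <= 2.
Proof.
move=> BP ltTS; apply/exists_inP; apply: contraLR ltTS.
rewrite negb_exists_in -leqNgt => /forall_inP deg3.
rewrite -(@leq_pmul2r 3) // -!sum_nat_const.
have -> : (\sum_(i in T) 3 = \sum_(j in S) #|[set i in T | j \in B i]|)%N.
  transitivity (\sum_(i in T) \sum_(j in S | j \in B i) 1)%N.
    apply: eq_bigr => i /BP[/setIidPr sBS <-]; rewrite sum1dep_card -{1}sBS.
    by apply: eq_card => j; rewrite !inE.
  rewrite (exchange_big_dep (mem S)) /=; last by move=> i j _ /andP[].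
  apply: eq_bigr => j jS; rewrite sum1dep_card.
  by apply: eq_card => i; rewrite !inE jS.
by apply: leq_sum => j /deg3; rewrite -ltnNge.
Qed.

(** In a three-term equation, once the other two terms are units, the values of
    the last variable that satisfy it form a sum of two units. *)
Lemma last_variable (H : finHyperfieldType) (J : finType) (A : {set J})
    (c x : J -> H) (p : J) :
  #|A| = 3 -> p \in A -> (forall j, j \in A -> c j != 0) ->
  (forall j, x j != 0) ->
  exists b d, [/\ b != 0, d != 0 &
    b + d \subset
      [set z | 0 \in lsum A c (fun j => if j == p then z else x j)]].
Proof.
move=> A3 pA c0 x0.
have /cards2P[q [r [qr defA]]] : #|A :\ p| == 2.
  by move: A3; rewrite (cardsD1 p) pA => /succn_inj ->.
have /setD1P[qp qA] : q \in A :\ p by rewrite defA !inE eqxx.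
have /setD1P[rp rA] : r \in A :\ p by rewrite defA !inE eqxx orbT.
have [e e0 ec] := hmulV_ex _ (c0 p pA).
exists (e * hopp (c q * x q)), (e * hopp (c r * x r)).
split; try by rewrite hmul_neq0 ?hopp_neq0 ?hmul_neq0 ?c0.
apply/subsetP=> z /(mem_hmulD (c p)).
rewrite !hmulA (hmulC _ e) ec !hmul1 => /mem_hopp_hadd cz.
rewrite inE /lsum (big_setD1 p) //= defA big_setU1 ?inE //= big_set1 hadds1.
rewrite eqxx (negPf qp) (negPf rp); apply/haddsP.
by exists (c p * z), (hopp (c p * z)); rewrite inE hadd_opp.
Qed.

(** Induction on [S]: the variable of low degree is chosen after all the other
    variables of [S], and occurs in no three-term equation supported by
    them. *)
Lemma unit_assignment (H : finHyperfieldType) (I J : finType) (E : {set I})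
    (V : {set J}) (a : I -> J -> H) :
  meeting_sums H ->
  (forall S : {set J}, S \subset V -> S != set0 ->
     #|[set i in E | supp V (a i) \subset S]| < #|S|) ->
  forall S : {set J}, S \subset V ->
  exists2 x : J -> H, (forall j, x j != 0) &
    forall i, i \in E -> supp V (a i) \subset S -> #|supp V (a i)| = 3 ->
      0 \in lsum (supp V (a i)) (a i) x.
Proof.
move=> meetH sparse S; have [n] := ubnP #|S|.
elim: n S => // n IHn S ltSn sSV; have [S0|Sn0] := eqVneq S set0.
  exists (fun=> 1) => [j|i _]; first exact: hone_neq0.
  by rewrite S0 subset0 => /eqP->; rewrite cards0.
pose T := [set i in E | (supp V (a i) \subset S) && (#|supp V (a i)| == 3)].
have [||p pS degp] := @low_degree I J T S (fun i => supp V (a i)).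
- by move=> i; rewrite inE => /and3P[_ ? /eqP].
- apply: leq_ltn_trans (sparse S sSV Sn0); apply/subset_leq_card/subsetP=> i.
  by rewrite !inE => /and3P[-> ->].
have [||x x0 xP] := IHn (S :\ p).
- by move: ltSn; rewrite (cardsD1 p) pS.
- exact: subset_trans (subsetDl _ _) sSV.
pose y z j := if j == p then z else x j.
have [|z z0 zP] := @common_unit_family H I _
    (fun i => [set z | 0 \in lsum (supp V (a i)) (a i) (y z)]) meetH degp.
  move=> i; rewrite inE => /andP[]; rewrite inE => /and3P[_ _ /eqP A3] pA.
  by apply: last_variable => // j; rewrite inE => /andP[].
exists (y z) => [j|i iE sAS A3]; first by rewrite /y; case: ifP.
have [pA|pA] := boolP (p \in supp V (a i)).
  have /zP : i \in [set i in T | p \in supp V (a i)].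
    by rewrite inE pA inE iE sAS A3 eqxx.
  by rewrite inE.
have -> : lsum (supp V (a i)) (a i) (y z) = lsum (supp V (a i)) (a i) x.
  by apply: eq_bigr => j jA; rewrite /y; case: eqVneq jA pA => // -> ->.
by apply: xP => //; rewrite subsetD1 sAS.
Qed.

(** * Solving the system *)

(** Two variables [p] and [q] with [x q = t * x p] can be merged into one, with
    any element of [c p + c q * t] as coefficient. *)
Lemma merge_variables (H : finHyperfieldType) (J : finType) (V : {set J})
    (c c' x y : J -> H) (p q : J) (t : H) :
  p \in V -> q \in V -> p != q -> y q = t * x p ->
  (forall j, j != q -> y j = x j) ->
  c' p \in c p + c q * t -> (forall j, j != p -> c' j = c j) ->
  lsum (V :\ q) c' x \subset lsum V c y.
Proof.
move=> pV qV pq yq yE c'p c'E.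
have pVq : p \in V :\ q by rewrite !inE pq.
rewrite /lsum (big_setD1 q qV) /= !(big_setD1 p pVq) /= haddsA (yE p pq).
apply: haddsS.
  rewrite hadds1 sub1set yq haddC hmulA !(hmulC _ (x p)).
  exact: mem_hmulD.
rewrite (eq_bigr (fun j => [set c j * y j])) // => j /setD1P[jp /setD1P[jq _]].
by rewrite c'E ?yE.
Qed.

(** The system is cut out of a fixed ambient array [a] by a set [E] of equations
    and a set [V] of variables, so that both reductions stay within the same
    index types. *)
Lemma underdetermined_system (H : finHyperfieldType) (I J : finType)
    (E : {set I}) (V : {set J}) (a : I -> J -> H) :
  meeting_sums H -> #|E| < #|V| ->
  exists x : J -> H, (exists2 j, j \in V & x j != 0) /\
    forall i, i \in E -> 0 \in lsum V (a i) x.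
Proof.
move=> meetH; have [n] := ubnP #|E|.
elim: n E V a => // n IHn E V a ltEn ltEV.
pose ES (S : {set J}) := [set i in E | supp V (a i) \subset S].
have sES S : ES S \subset E by apply/subsetP=> i /[!inE] /andP[].
have [/existsP[S /and3P[sSV ESn0 leS]]|noS] := boolP
    [exists S : {set J}, [&& S \subset V, ES S != set0 & #|S| <= #|ES S|]].
  have cE := cardsID (ES S) E; have cV := cardsID S V.
  rewrite (setIidPr (sES S)) in cE; rewrite (setIidPr sSV) in cV.
  have ES_gt0 : 0 < #|ES S| by rewrite card_gt0.
  have [||x [[j jVS xj] xP]] := IHn (E :\: ES S) (V :\: S) a.
  - by rewrite -ltnS (leq_trans _ ltEn) // -cE !ltnS -add1n leq_add2r.
  - rewrite -(ltn_add2l #|ES S|) cE (leq_trans ltEV) // -cV leq_add2r //.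
  pose y j := if j \in S then 0 else x j.
  exists y; split.
    move: jVS => /setDP[jV jS].
    by exists j => //; rewrite /y (negPf jS).
  move=> i iE; have [iS|iS] := boolP (i \in ES S).
    rewrite lsum_supp /lsum big1 ?inE // => j' j'A.
    move: iS; rewrite inE => /andP[_ /subsetP/(_ _ j'A) j'S].
    by rewrite /y j'S hmulr0.
  suff -> : lsum V (a i) y = lsum (V :\: S) (a i) x by apply: xP; rewrite inE iS.
  rewrite /lsum (big_setID S) /= big1 ?hadds0.
    by apply: eq_bigr => j' /setDP[_ j'S]; rewrite /y (negPf j'S).
  by move=> j' /setIP[_ j'S]; rewrite /y j'S hmulr0.
have sparse (S : {set J}) : S \subset V -> ES S != set0 -> #|ES S| < #|S|.
  move=> sSV ESn0; move: noS; rewrite negb_exists => /forallP/(_ S).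
  by rewrite sSV ESn0 -ltnNge.
have suppV i : supp V (a i) \subset V by apply/subsetP=> j /[!inE] /andP[].
have [/exists_inP[i iE /cards2P[p [q [pq defA]]]]|no2] :=
    boolP [exists i in E, #|supp V (a i)| == 2].
  have /[!inE]/andP[pV ap] : p \in supp V (a i) by rewrite defA !inE eqxx.
  have /[!inE]/andP[qV aq] : q \in supp V (a i).
    by rewrite defA !inE eqxx orbT.
  have [e e0 ea] := hmulV_ex _ aq.
  (* the ratio x q / x p that equation i imposes *)
  pose t := e * hopp (a i p).
  pose a' i j := if j == p then odflt 0 [pick d in a i p + a i q * t] else a i j.
  have a'p i' : a' i' p \in a i' p + a i' q * t.
    rewrite /a' eqxx; case: pickP => [d|none] //=.
    have /set0Pn[d] := hadd_neq0 (a i' p) (a i' q * t).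
    by rewrite none.
  have [||x [[j jV xj] xP]] := IHn (E :\ i) (V :\ q) a'.
  - by move: ltEn; rewrite (cardsD1 i) iE.
  - by move: ltEV; rewrite (cardsD1 i) iE (cardsD1 q) qV.
  pose y j := if j == q then t * x p else x j.
  have yq : y q = t * x p by rewrite /y eqxx.
  have yE j' : j' != q -> y j' = x j' by rewrite /y => /negPf->.
  exists y; split.
    by move: jV => /setD1P[jq jV]; exists j; rewrite ?yE.
  move=> i' i'E; have [->|i'i] := eqVneq i' i.
    rewrite lsum_supp defA /lsum big_setU1 ?inE //= big_set1 hadds1 yq yE //.
    rewrite /t !hmulA (hmulC _ e) ea hmul1 -hopp_mul1 -hmulA hopp_mul1.
    exact: hadd_opp.
  have {xP}/xP : i' \in E :\ i by rewrite !inE i'i.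
  apply: subsetP; apply: (merge_variables pV qV pq yq yE) => // j' j'p.
  by rewrite /a' (negPf j'p).
(* sparsity at the support of equation i excludes supports of size 0 and 1 *)
have supp3 i : i \in E -> 2 < #|supp V (a i)|.
  move=> iE; have iS : i \in ES (supp V (a i)) by rewrite inE iE subxx.
  have ESn0 : ES (supp V (a i)) != set0 by apply/set0Pn; exists i.
  rewrite ltn_neqAle eq_sym; apply/andP; split.
    by move: no2; rewrite negb_exists_in => /forall_inP/(_ i iE).
  by apply: leq_ltn_trans (sparse _ (suppV i) ESn0); rewrite card_gt0.
have [|//|x x0 xP] := @unit_assignment H I J E V a meetH _ V.
  move=> S sSV Sn0; have [ES0|/sparse] := eqVneq (ES S) set0; last exact.
  by rewrite [X in #|pred_of_set X|]ES0 cards0 card_gt0.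
exists x; split.
  have [j jV] : exists j, j \in V by apply/card_gt0P; apply: leq_trans ltEV.
  by exists j.
move=> i iE; rewrite lsum_supp; have := supp3 i iE.
rewrite leq_eqVlt => /predU1P[A3|A4]; first exact: xP.
apply: zero_in_sum4 => // j; rewrite inE => /andP[_ aij].
by rewrite hmul_neq0.
Qed.

Theorem theorem5p2 (H : finHyperfieldType) : ample H -> FETVINS H.
Proof.
move=> /common_unit meetH k n a ltkn.
have [|x [[j _ xj] xP]] :=
    @underdetermined_system H 'I_k 'I_n [set: 'I_k] [set: 'I_n] a meetH.
  by rewrite !cardsT !card_ord.
exists x; split; first by exists j; apply/eqP.
move=> i; have := xP i (in_setT i).
by rewrite /lsum /hsum (eq_bigl predT) // => j'; rewrite inE.
Qed.
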